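(* Let $0<x\le1$ satisfy $2x+\sqrt{x}\le x(1+\sqrt{x})^2$. Then, for every $n\ge1$, $$a_n\le 2^{5n}\,n^{\,n\log_2(1+\sqrt{x})}.$$ The smallest $x\in(0,1]$ satisfying the condition $2x+\sqrt{x}\le x(1+\sqrt{x})^2$ is $x^*=\left(2\cos\frac{\pi}{7}-1\right)^2$, and hence, for every $n\ge1$, $$a_n\le 2^{5n}n^{\beta n},\qquad \beta=\log_2\!\left(2\cos\frac{\pi}{7}\right).$$
   Context: $\mathfrak S_n$ is the set of permutations $\pi=\pi_1\cdots\pi_n$ of $\{1,\dots,n\}$. An occurrence of the boxed pattern $\mathrm{Box}(123)$ in $\pi\in\mathfrak S_n$ is a choice of positions $i_1<i_2<i_3$ with $\pi_{i_1}<\pi_{i_2}<\pi_{i_3}$ such that no index $j\ne i_2$ satisfies $i_1<j<i_3$ and $\pi_{i_1}<\pi_j<\pi_{i_3}$. $a_n$ is the number of permutations in $\mathfrak S_n$ with no occurrence of $\mathrm{Box}(123)$. *)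

(* Defs.v *)
From HB Require Import structures.
From mathcomp Require Import all_boot all_order all_algebra all_fingroup.
From mathcomp Require Import all_classical all_reals all_analysis.

Set Implicit Arguments.
Unset Strict Implicit.
Unset Printing Implicit Defensive.

Import Order.TTheory GRing.Theory Num.Theory.

Local Open Scope ring_scope.

(* Positions and values are both shifted from {1..n} to {0..n-1}. *)
Definition box123_occ (n : nat) (s : 'S_n) (i1 i2 i3 : 'I_n) : bool :=
  [&& (i1 < i2 < i3)%N, (s i1 < s i2 < s i3)%N &
      ~~ [exists j : 'I_n,
            [&& j != i2, (i1 < j < i3)%N & (s i1 < s j < s i3)%N]]].

Definition avoids_box123 (n : nat) (s : 'S_n) : bool :=
  ~~ [exists i1 : 'I_n, [exists i2 : 'I_n, [exists i3 : 'I_n,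
        box123_occ s i1 i2 i3]]].

Definition a_ (n : nat) : nat := #|[set s : 'S_n | avoids_box123 s]|.

Definition log2 (R : realType) (y : R) : R := ln y / ln 2.

Definition admissible (R : realType) (x : R) : Prop :=
  0 < x <= 1 /\ 2 * x + Num.sqrt x <= x * (1 + Num.sqrt x) ^+ 2.

(* Main.v *)
Require Import Defs.
From HB Require Import structures.
From mathcomp Require Import all_boot all_order all_algebra all_fingroup.
From mathcomp Require Import all_classical all_reals all_analysis.
From mathcomp Require Import ring lra zify.

(** Write x = r ^+ 2 and L = 1 + r.  Admissibility of x amounts to
    1 + 2 * r <= r * L ^+ 2.

    If a permutation avoids Box(123), then no restriction of it to an interval
    of values has two consecutive ascents ([avoids_box_free]).  This property,
    [box_free], is stable under restriction to intervals of values.  Give each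
    arrangement the weight x ^ (number of ascents) and let [box_sum I] be the
    total weight of the box-free arrangements of an interval I.

    Cut the interval into low values and high values.  A box-free arrangement
    is a shuffle of its low part s and its high part t, both box-free, and the
    shuffle has no two consecutive ascents.  The heart of the proof
    ([shuffle_sum_bounds]) is that, for fixed s and t, the total weight of such
    shuffles is at most L / r * L ^ (length) times the product of the weights
    of s and t.  If s and t are both decreasing, an ascent of the shuffle is a
    switch from low to high, and summing x ^ (number of such switches) over
    words in two letters gives the transfer matrix with rows (1, x) and (1, 1),
    of largest eigenvalue 1 + sqrt x = L.  An ascent of s is paid for by a
    factor x on the right.  If the shuffle keeps it, the factor is recovered
    but the next step is forced to stay low, which loses a factor L; if the
    shuffle breaks it by an excursion among the high values, the factor x is
    gained back.  Adding the two possibilities, normalized by L at each step,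
    gives 1 / L ^ 2 + 1 / (r * L) <= 1, which is the admissibility condition.

    Hence box_sum (n) <= L / r * L ^ n * box_sum (n / 2) * box_sum (n - n / 2)
    ([box_sum_split]).  The recursion has about log2 n levels, each
    contributing L ^ n, and n - 1 splittings, each contributing L / r
    ([box_sum_bound]).  Returning from weights to cardinals costs x ^- n, and
    the exponential factors collect into (L ^ 2 / r ^ 3) ^ n <= 32 ^ n because
    1 / 2 <= r <= 1.

    The least admissible x comes from the root of r * (1 + r) ^ 2 = 1 + 2 * r,
    which is 2 * cos (pi / 7) - 1 by the relation cos (4 * t) = - cos (3 * t)
    at t = pi / 7. *)

Set Implicit Arguments.
Unset Strict Implicit.
Unset Printing Implicit Defensive.

Import Order.TTheory GRing.Theory Num.Theory.

Local Open Scope ring_scope.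

(** * Ascents and shuffles of sequences of naturals *)

Fixpoint asc (y : nat) (s : seq nat) : nat :=
  if s is z :: s' then ((y < z) + asc z s')%N else 0.

(** The flag [e] records whether the step leading to [y] was an ascent. *)
Fixpoint no_double_asc (e : bool) (y : nat) (s : seq nat) : bool :=
  if s is z :: s' then ~~ (e && (y < z)%N) && no_double_asc (y < z)%N z s'
  else true.

Definition rises (y : nat) (s : seq nat) : bool :=
  if s is z :: _ then (y < z)%N else false.

Definition rises1 (s : seq nat) : bool :=
  if s is z :: s' then rises z s' else false.

(** Taking the first entry as its own predecessor adds no ascent. *)
Definition asc1 (s : seq nat) : nat := asc (head 0%N s) s.

Fixpoint shuffles (s : seq nat) : seq nat -> seq (seq nat) :=
  fix sh (t : seq nat) :=
    if s is a :: s' then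
      if t is b :: t' then
        [seq a :: u | u <- shuffles s' t] ++ [seq b :: u | u <- sh t']
      else [:: s]
    else [:: t].

Lemma asc_cons y s : asc y s = (rises y s + asc1 s)%N.
Proof. by case: s => // z s; rewrite /asc1 /= ltnn. Qed.

Lemma asc1_cons z s : asc1 (z :: s) = asc z s.
Proof. by rewrite /asc1 /= ltnn. Qed.

Lemma shuffles0s t : shuffles [::] t = [:: t].
Proof. by case: t. Qed.

Lemma shuffless0 s : shuffles s [::] = [:: s].
Proof. by case: s. Qed.

Lemma mem_shuffles (p : pred nat) (u : seq nat) :
  u \in shuffles [seq z <- u | p z] [seq z <- u | ~~ p z].
Proof.
elim: u => // z u IHu /=; case: (p z) => /=; move: IHu.
- case: [seq z <- u | ~~ p z] => [|b t].
    by rewrite !shuffless0 !inE => /eqP <-.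
  by move=> IHu; rewrite mem_cat map_f.
- case: [seq z <- u | p z] => [|a s].
    by rewrite !shuffles0s !inE => /eqP <-.
  by move=> IHu; rewrite /= mem_cat orbC map_f.
Qed.

(** * The weight of the shuffles of two sequences *)

Section Transfer.

Variables (R : realFieldType) (r : R).
Hypothesis r_gt0 : 0 < r.
Hypothesis r_adm : 1 + 2 * r <= r * (1 + r) ^+ 2.

Definition weight (e : bool) (y : nat) (u : seq nat) : R :=
  if no_double_asc e y u then r ^+ (2 * asc y u) else 0.

Definition step (e : bool) (y z : nat) : R :=
  if (y < z)%N then (if e then 0 else r ^+ 2) else 1.

(** The total weight of the continuations of a partial shuffle that ended at
    [y], where [s] and [t] are still to be inserted. *)
Definition shuffle_sum (e : bool) (y : nat) (s t : seq nat) : R :=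
  \sum_(u <- shuffles s t) weight e y u.

Lemma weight_ge0 e y u : 0 <= weight e y u.
Proof. by rewrite /weight; case: ifP => // _; rewrite exprn_ge0 // ltW. Qed.

Lemma weight_cons e y z u :
  weight e y (z :: u) = step e y z * weight (y < z)%N z u.
Proof.
rewrite /weight /step /=; case: (y < z)%N => /=; last by rewrite andbF mul1r.
case: e => /=; first by rewrite mul0r.
by case: no_double_asc; rewrite ?mulr0 // mulnDr exprD.
Qed.

Lemma step_ge0 e y z : 0 <= step e y z.
Proof.
by rewrite /step; case: ifP => // _; case: e => //; rewrite exprn_ge0 // ltW.
Qed.

Lemma shuffle_sum0 e y : shuffle_sum e y [::] [::] = 1.
Proof. by rewrite /shuffle_sum /= big_seq1 /weight /=. Qed.

Lemma shuffle_sum_rec e y s t : (0 < size s + size t)%N ->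
  shuffle_sum e y s t =
    (if s is a :: s' then step e y a * shuffle_sum (y < a)%N a s' t else 0)
  + (if t is b :: t' then step e y b * shuffle_sum (y < b)%N b s t' else 0).
Proof.
rewrite /shuffle_sum; case: s t => [|a s] [|b t] // _.
- by rewrite !shuffles0s !big_seq1 weight_cons add0r.
- by rewrite !shuffless0 !big_seq1 weight_cons addr0.
rewrite [shuffles _ _]/= big_cat /= !big_map !mulr_sumr; congr (_ + _);
  by apply: eq_bigr => u _; rewrite weight_cons.
Qed.

Let L := 1 + r.

(** The correction for a next high entry that is followed by an ascent: going up
    to that entry forces an immediate return to the low values. *)
Definition eta (b : bool) : R := if b then (L * r)^-1 else 1.

(** The value, relative to the one of a descending step, of standing on the high
    entry [y] when [t] remains.  When a step up to [t] would be an ascent, it is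
    forbidden after an ascent ([e]), and then the shuffle has to go down. *)
Definition eps (e : bool) (y : nat) (t : seq nat) : R :=
  if rises y t then (if e then eta true * eta (rises1 t) else r^-1) else 1.

(** Potentials for the recursion [shuffle_sum_rec], according to whether the last
    entry [y] is low or high.  Both count the ascents of the part that contains
    [y] starting from [y], but those of the other part only from its next entry
    on: the gap of that other part has already been broken, so that it carries
    no ascent of the shuffle any more.  A low entry reached by an ascent must be
    followed by a low one, whence the factor [L^-1]. *)
Definition low_bound (e : bool) (y : nat) (s t : seq nat) : R :=
  L / r * ((if e then L^-1 else 1) * r * eta (rises1 t)
    * L ^+ (size s + size t) * r ^+ (2 * (asc y s + asc1 t))).

Definition high_bound (e : bool) (y : nat) (s t : seq nat) : R :=
  L / r * (eps e y t
    * L ^+ (size s + size t) * r ^+ (2 * (asc1 s + asc y t))).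

Lemma L_gt0 : 0 < L.
Proof. by rewrite addr_gt0. Qed.

Lemma Lr_ge1 : 1 <= L * r.
Proof.
rewrite -(ler_pM2r L_gt0) mul1r [L * r]mulrC -mulrA -expr2.
by apply: le_trans r_adm; rewrite /L; have := r_gt0; lra.
Qed.

Lemma eta_gt0 b : 0 < eta b.
Proof. by case: b; rewrite /eta // invr_gt0 mulr_gt0 // L_gt0. Qed.

Lemma eta_le1 b : eta b <= 1.
Proof. by case: b; rewrite /eta // invf_le1 ?Lr_ge1 // mulr_gt0 // L_gt0. Qed.

Lemma eps_true_le b t : eps true b t <= eta (rises b t).
Proof.
rewrite /eps; case: (rises b t) => //.
by rewrite ger_pMr ?eta_gt0 // eta_le1.
Qed.

(** The admissibility condition in the form used: the value of an ascent of the
    low part, either kept (and followed by a forced step) or broken. *)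
Lemma r_adm_inv : r * L^-1 + 1 <= r * L.
Proof.
rewrite -(ler_pM2r L_gt0) mulrDl mul1r mulfVK ?gt_eqF ?L_gt0 //.
by rewrite -mulrA -expr2; apply: le_trans r_adm; rewrite /L; have := r_gt0; lra.
Qed.

(** The potential inequality at a low entry, with common factors removed: the
    first summand is the step to the next low entry, which is an ascent iff [v];
    the second is the step to the next high entry. *)
Lemma low_scalar (e v : bool) :
  r * (if v then (if e then 0 else L^-1) else 1)
    + (if e then 0 else if v then 1 else r ^+ 2)
  <= r * L * (if e then L^-1 else 1).
Proof.
case: e v => [] [] /=; rewrite ?mulr0 ?addr0 ?mulr1 ?mulfK ?gt_eqF ?L_gt0 //.
- exact: ltW.
- exact: r_adm_inv.
- by rewrite /L mulrDr mulr1.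
Qed.

(** The same at a high entry: the first summand is the step to the next high
    entry, which is an ascent iff [v], and [h'] tells whether that entry is
    followed by an ascent; the second is the step down to the low part. *)
Lemma high_scalar (e v h' : bool) :
  (if v then (if e then 0 else eta h') else if h' then r^-1 else 1)
    + (if v then eta h' / r else r * eta h')
  <= L * (if v then (if e then eta true * eta h' else r^-1) else 1).
Proof.
have Lu : L != 0 by rewrite gt_eqF ?L_gt0.
have ru : r != 0 by rewrite gt_eqF.
case: v => /=; last first.
  rewrite mulr1; case: h' => /=; last by rewrite mulr1 /L.
  have -> : r^-1 + r * (L * r)^-1 = (r * L^-1 + 1) / r by field; rewrite Lu ru.
  by rewrite ler_pdivrMr // [L * r]mulrC r_adm_inv.
case: e => /=.
  have -> : L * (eta true * eta h') = eta h' / r 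
    by rewrite [eta true]/eta invfM !mulrA mulfV // mul1r mulrC.
  by rewrite add0r.
have -> : eta h' + eta h' / r = (L / r) * eta h' by rewrite /L; field.
by rewrite ler_piMr ?eta_le1 // divr_ge0 // ltW // L_gt0.
Qed.

(** Induction on the number of entries left: one step of [shuffle_sum_rec]
    reduces to the scalar inequalities above.  The two bounds are proved together
    since a shuffle alternates between low and high entries. *)
Lemma shuffle_sum_bounds (e : bool) (y : nat) (s t : seq nat) (b : nat) :
  all (fun z => z < b)%N s -> all (fun z => b <= z)%N t ->
    ((y < b)%N -> shuffle_sum e y s t <= low_bound e y s t)
 /\ ((b <= y)%N -> shuffle_sum e y s t <= high_bound e y s t).
Proof.
have [N leN] := ubnP (size s + size t).
elim: N s t e y leN => // N IHN s t e y leN sb bt.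
have Lr0 : 0 <= L / r by rewrite divr_ge0 // ltW // L_gt0.
case: (posnP (size s + size t)) => [|nz].
  case: s t {leN sb bt} => [|//] [|//] _; rewrite shuffle_sum0; split => _.
  - rewrite /low_bound /= !expr0 !mulr1 mulrA mulrAC mulfVK ?gt_eqF //.
    by case: e; rewrite ?mulfV ?mulr1 ?gt_eqF ?L_gt0 // /L; have := r_gt0; lra.
  - rewrite /high_bound /eps /= !mulr1 ler_pdivlMr // mul1r /L.
    by have := r_gt0; lra.
rewrite shuffle_sum_rec //; split => yb.
- set K := L / r * eta (rises1 t) * L ^+ (size s + size t).-1
             * r ^+ (2 * (asc y s + asc1 t)).
  have K0 : 0 <= K.
    by rewrite !mulr_ge0 ?exprn_ge0 ?invr_ge0
      ?(ltW (eta_gt0 _)) ?(ltW L_gt0) ?(ltW r_gt0).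
  have -> : low_bound e y s t = K * (r * L * (if e then L^-1 else 1)).
    rewrite /low_bound /K -{1}(prednK nz) exprS.
    move: (eta _) (L ^+ _) (r ^+ _) => x1 x2 x3; set x4 := (if e then _ else _).
    ring.
  apply: le_trans (ler_wpM2l K0 (low_scalar e (rises y s))).
  rewrite mulrDr lerD //.
  (* next entry low *)
  + case: s leN sb {nz} @K K0 => [|a s] leN sb K K0.
      by rewrite /= mulr1 mulr_ge0 // ltW.
    have /andP[ab sb'] : (a < b)%N && all (fun z => z < b)%N s by [].
    have [lowa _] := IHN s t (y < a)%N a leN sb' bt.
    apply: le_trans (ler_wpM2l (step_ge0 e y a) (lowa ab)) _.
    rewrite /step /low_bound /K /=; case: (y < a)%N => /=; last first.
      rewrite add0n mul1r mul1r mulr1 le_eqVlt; apply/orP; left; apply/eqP.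
      by ring.
    case: e => /=; first by rewrite mul0r mulr0 mulr0.
    have -> : (2 * (1 + asc a s + asc1 t) = 2 + 2 * (asc a s + asc1 t))%N
      by rewrite -addnA mulnDr.
    rewrite [r ^+ (2 + _)]exprD.
    by rewrite le_eqVlt; apply/orP; left; apply/eqP; ring.
  (* next entry high *)
  + case: t leN bt {nz} @K K0 => [|c t] leN bt K K0.
      rewrite mulr_ge0 //; case: e => //.
      by case: (rises y s) => //; rewrite exprn_ge0 // ltW.
    have /andP[bc bt'] : (b <= c)%N && all (fun z => b <= z)%N t by [].
    have leN' : (size s + size t < N)%N by move: leN; rewrite /= addnS.
    have yc : (y < c)%N by apply: leq_trans yb bc.
    have [_ highc] := IHN s t true c leN' sb bt'.
    rewrite /step yc; case: e; first by rewrite mul0r mulr0.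
    have r2 : 0 <= r ^+ 2 by rewrite exprn_ge0 // ltW.
    apply: le_trans (ler_wpM2l r2 (highc bc)) _.
    rewrite /high_bound /K [asc y s]asc_cons asc1_cons addnS /=.
    set E := eps _ _ _; set A := L ^+ _.
    have EE : E <= eta (rises c t) by exact: eps_true_le.
    have A0 : 0 <= A by rewrite exprn_ge0 // ltW // L_gt0.
    have -> : (2 * (rises y s + asc1 s + asc c t)
            = 2 * rises y s + 2 * (asc1 s + asc c t))%N
      by rewrite -addnA mulnDr.
    rewrite [r ^+ (_ + 2 * _)]exprD; set B := r ^+ (2 * (asc1 s + asc c t)).
    have B0 : 0 <= B by rewrite exprn_ge0 // ltW.
    have -> : L / r * eta (rises c t) * A * (r ^+ (2 * rises y s) * B)
        * (if rises y s then 1 else r ^+ 2)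
        = r ^+ 2 * (L / r * (eta (rises c t) * A * B)).
      by case: (rises y s); rewrite ?muln1 ?muln0 ?expr0; ring.
    by rewrite !ler_wpM2l // !ler_wpM2r.
set K := L / r * L ^+ (size s + size t).-1 * r ^+ (2 * (asc1 s + asc y t)).
have K0 : 0 <= K.
  by rewrite !mulr_ge0 ?exprn_ge0 ?invr_ge0 ?(ltW L_gt0) ?(ltW r_gt0).
have -> : high_bound e y s t = K * (L * eps e y t).
  rewrite /high_bound /K -{1}(prednK nz) exprS.
  by move: (eps _ _ _) (L ^+ _) (r ^+ _) => x1 x2 x3; ring.
apply: le_trans (ler_wpM2l K0 (high_scalar e (rises y t) (rises1 t))).
rewrite mulrDr addrC lerD //.
(* next entry high *)
- case: t leN bt {nz} @K K0 => [|c t] leN bt K K0; first by rewrite mulr1.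
  have /andP[bc bt'] : (b <= c)%N && all (fun z => b <= z)%N t by [].
  have leN' : (size s + size t < N)%N by move: leN; rewrite /= addnS.
  have [_ highc] := IHN s t (y < c)%N c leN' sb bt'.
  apply: le_trans (ler_wpM2l (step_ge0 e y c) (highc bc)) _.
  rewrite /high_bound /step /K addnS /=.
  set A := L ^+ _.
  have A0 : 0 <= A by rewrite exprn_ge0 // ltW // L_gt0.
  have -> : (2 * (asc1 s + ((y < c) + asc c t))
          = 2 * (y < c)%N + 2 * (asc1 s + asc c t))%N
    by rewrite addnCA mulnDr.
  rewrite [r ^+ (_ + 2 * _)]exprD; set B := r ^+ (2 * (asc1 s + asc c t)).
  have B0 : 0 <= B by rewrite exprn_ge0 // ltW.
  case: (y < c)%N; last first.
    rewrite muln0 expr0 /eps /= !mul1r; case: (rises c t);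
      by rewrite le_eqVlt; apply/orP; left; apply/eqP; ring.
  rewrite muln1; case: e; first by rewrite mul0r mulr0.
  have EE := eps_true_le c t.
  have -> : L / r * A * (r ^+ 2 * B) * eta (rises c t)
          = r ^+ 2 * (L / r * (eta (rises c t) * A * B)) by ring.
  by rewrite !ler_wpM2l // ?exprn_ge0 ?(ltW r_gt0) // !ler_wpM2r.
(* next entry low *)
- case: s leN sb {nz} @K K0 => [|a s] leN sb K K0.
    rewrite mulr_ge0 //; have eta0 := ltW (eta_gt0 (rises1 t)).
    by case: (rises y t); rewrite ?divr_ge0 ?mulr_ge0 // ltW.
  have /andP[ab sb'] : (a < b)%N && all (fun z => z < b)%N s by [].
  have ya : (y < a)%N = false.
    by apply/negbTE; rewrite -leqNgt ltnW // (leq_trans ab).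
  have [lowa _] := IHN s t false a leN sb' bt.
  rewrite /step ya mul1r; apply: le_trans (lowa ab) _.
  rewrite /low_bound /K [asc y t]asc_cons asc1_cons /=.
  have -> : (2 * (asc a s + (rises y t + asc1 t))
          = 2 * rises y t + 2 * (asc a s + asc1 t))%N
    by rewrite addnCA mulnDr.
  rewrite [r ^+ (_ + 2 * _)]exprD; set B := r ^+ (2 * (asc a s + asc1 t)).
  have ru : r != 0 by rewrite gt_eqF.
  rewrite le_eqVlt; apply/orP; left; apply/eqP.
  case: (rises y t); last by rewrite muln0 expr0; ring.
  by rewrite muln1; field.
Qed.

End Transfer.

(** * Box-free sequences *)

Definition window (lo hi : nat) (u : seq nat) : seq nat :=
  [seq z <- u | (lo <= z < hi)%N].

Definition no_double_asc1 (u : seq nat) : bool :=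
  no_double_asc false (head 0%N u) u.

(** For distinct values this is avoidance of Box(123): an occurrence is a pair
    of consecutive ascents in the restriction to the values between its extreme
    entries.  In this form the stability under restriction to an interval is
    immediate. *)
Definition box_free (u : seq nat) : bool :=
  `[< forall lo hi, no_double_asc1 (window lo hi u) >].

Lemma box_free_window lo hi u : box_free u -> box_free (window lo hi u).
Proof.
move=> /asboolP bf; apply/asboolP => lo' hi'.
suff -> : window lo' hi' (window lo hi u)
        = window (maxn lo lo') (minn hi hi') u by [].
rewrite /window -filter_predI; apply: eq_filter => z /=.
rewrite geq_max leq_min; case: (lo <= z)%N; case: (lo' <= z)%N;
  by rewrite ?andbF //= andbC.
Qed.

(** A double ascent shows up as three consecutive entries. *)
Lemma no_double_asc_intro (e : bool) (y : nat) (u : seq nat) :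
  ~~ (e && rises y u) ->
  (forall v a b c w, y :: u = v ++ [:: a, b, c & w] -> ~~ (a < b < c)%N) ->
  no_double_asc e y u.
Proof.
elim: u e y => //= z u IHu e y -> H; apply: IHu => [|v a b c w E].
  case: u H => [|c u] H; [by rewrite andbF | exact: (H [::] y z c u)].
by apply: (H (y :: v) a b c w); rewrite E.
Qed.

Lemma filter_eq_cat_cons (p : pred nat) (u v w : seq nat) (a : nat) :
  [seq z <- u | p z] = v ++ a :: w ->
  exists u1 u2, [/\ u = u1 ++ a :: u2, p a,
    [seq z <- u1 | p z] = v & [seq z <- u2 | p z] = w].
Proof.
elim: u v => [|z u IHu] v /=; first by case: v.
case: ifP => pz; last first.
  move=> /IHu [u1 [u2 [-> pa <- <-]]]; exists (z :: u1), u2.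
  by rewrite /= pz.
case: v => [|z' v] /= [za E]; first by exists [::], u; rewrite -za.
by have [u1 [u2 [-> pa <- <-]]] := IHu _ E; exists (z :: u1), u2; rewrite /= pz za.
Qed.

Definition one_line (n : nat) (s : 'S_n) : seq nat :=
  [seq val (s i) | i <- enum 'I_n].

Lemma size_one_line n (s : 'S_n) : size (one_line s) = n.
Proof. by rewrite size_map size_enum_ord. Qed.

Lemma nth_one_line n (s : 'S_n) (i : 'I_n) : nth 0%N (one_line s) i = s i.
Proof. by rewrite (nth_map i) ?size_enum_ord // nth_ord_enum. Qed.

Lemma one_line_inj n : injective (@one_line n).
Proof.
move=> s1 s2 E; apply/permP => i; apply: val_inj.
by rewrite /= -!nth_one_line E.
Qed.

Lemma perm_one_line n (s : 'S_n) : perm_eq (one_line s) (iota 0 n).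
Proof.
apply: uniq_perm; rewrite ?iota_uniq //.
  by rewrite map_inj_uniq ?enum_uniq // => i j /val_inj /perm_inj.
move=> z; rewrite mem_iota add0n /=.
apply/mapP/idP => [[i _ ->]|zn]; first exact: ltn_ord.
by exists (s^-1%g (Ordinal zn)); rewrite ?mem_enum // permKV.
Qed.

(** Three consecutive increasing entries of a restriction to an interval of
    values are an occurrence of the boxed pattern: the entries of the
    permutation between them have been filtered out, so that they lie outside
    that interval, and a fortiori outside the box. *)
Lemma avoids_box_free n (s : 'S_n) : avoids_box123 s -> box_free (one_line s).
Proof.
move=> av; apply/asboolP => lo hi; rewrite /no_double_asc1.
apply: no_double_asc_intro => // v a b c w E; apply/negP => /andP[ab bc].
(* the sequence starts with a repeated head, which cannot be part of an ascent *)
have {v w E} [v [w E]] :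
    exists v w, window lo hi (one_line s) = v ++ [:: a, b, c & w].
  case: (window lo hi (one_line s)) E => [|z u] /=.
    by case: v => [|? [|? []]].
  case: v => [|z' v] /= [].
    by move=> aE bE; move: ab; rewrite -aE -bE ltnn.
  by move=> _ ->; exists v, w.
have [u1 [u2 [Eu pa _ E2]]] := filter_eq_cat_cons E.
have [u3 [u4 [Eu2 pb E3 E4]]] := filter_eq_cat_cons (v := [::]) E2.
have [u5 [u6 [Eu4 pc E5 _]]] := filter_eq_cat_cons (v := [::]) E4.
have Eall : one_line s = u1 ++ a :: u3 ++ b :: u5 ++ c :: u6.
  by rewrite Eu Eu2 Eu4.
have sz := size_one_line s; rewrite Eall !size_cat /= !size_cat /= size_cat /= in sz.
have l1 : (size u1 < n)%N by lia.
have l2 : (size u1 + (size u3).+1 < n)%N by lia.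
have l3 : (size u1 + (size u3).+1 + (size u5).+1 < n)%N by lia.
have s1 : s (Ordinal l1) = a :> nat.
  by rewrite -nth_one_line Eall /= nth_cat ltnn subnn.
have s2 : s (Ordinal l2) = b :> nat.
  rewrite -nth_one_line Eall /= nth_cat ifN -?leqNgt ?leq_addr // addKn /=.
  by rewrite nth_cat ltnn subnn.
have s3 : s (Ordinal l3) = c :> nat.
  rewrite -nth_one_line Eall /= nth_cat ifN -?leqNgt -?addnA ?leq_addr // addKn /=.
  rewrite nth_cat ifN -?leqNgt ?leq_addr // addKn /=.
  by rewrite nth_cat ltnn subnn.
move/negP: av; apply; apply/existsP; exists (Ordinal l1); apply/existsP.
exists (Ordinal l2); apply/existsP; exists (Ordinal l3).
rewrite /box123_occ s1 s2 s3 ab bc /=; apply/andP; split; first by lia.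
apply/existsP => -[j /and3P[j2 /andP[j1 j3] /andP[aj jc]]].
have inw : (lo <= s j < hi)%N by move: pa pc => /=; lia.
move: inw; apply/negP.
rewrite -nth_one_line Eall nth_cat ifN -?leqNgt ?(ltnW j1) //.
have -> : (j - size u1 = (j - size u1).-1.+1)%N by move: j1 => /=; lia.
rewrite /= nth_cat; case: ifP => jb.
  move/eqP: E3; rewrite -[_ == _]negbK -has_filter => /hasPn.
  by apply; apply: mem_nth.
have jb' : (size u1 + (size u3).+1 < j)%N.
  have : nat_of_ord j <> (size u1 + (size u3).+1)%N.
    by move=> h; move/eqP: j2; apply; apply: val_inj.
  by move: jb j1 => /=; lia.
have -> : ((j - size u1).-1 - size u3 = ((j - size u1).-1 - size u3).-1.+1)%N.
  by move: j1 jb' => /=; lia.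
rewrite /= nth_cat ifT; last by move: j3 jb' => /=; lia.
move/eqP: E5; rewrite -[_ == _]negbK -has_filter => /hasPn.
apply; apply: mem_nth.
by move: j3 jb' => /=; lia.
Qed.

Lemma ler_sum_uniq_sub (R : numDomainType) (T : eqType) (u v : seq T)
    (f : T -> R) :
  uniq u -> {subset u <= v} -> (forall z, 0 <= f z) ->
  \sum_(z <- u) f z <= \sum_(z <- v) f z.
Proof.
move=> + + f0; elim: u v => [|z u IHu] v /=.
  by move=> _ _; rewrite big_nil; apply: sumr_ge0.
move=> /andP[zu uu] sub; have zv : z \in v by apply: sub; rewrite mem_head.
rewrite big_cons (perm_big _ (perm_to_rem zv)) big_cons lerD2l IHu // => y yu.
have : y \in z :: rem z v.
  by rewrite -(perm_mem (perm_to_rem zv)) sub // inE yu orbT.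
by rewrite inE => /orP[/eqP yz|//]; rewrite -yz yu in zu.
Qed.

Lemma no_double_asc_ge_head M u :
  all (leq^~ M) u -> no_double_asc false M u = no_double_asc1 u.
Proof.
by case: u => //= z u /andP[zM _]; rewrite /no_double_asc1 /= ltnn ltnNge zM.
Qed.

Lemma asc_ge_head M u : all (leq^~ M) u -> asc M u = asc1 u.
Proof. by case: u => //= z u /andP[zM _]; rewrite /asc1 /= ltnn ltnNge zM. Qed.

Lemma asc_le_size y u : (asc y u <= size u)%N.
Proof.
by elim: u y => //= z u IHu y; rewrite -[X in (_ <= X)%N]add1n leq_add ?leq_b1.
Qed.

(** * The recursion on the number of avoiders *)

Section Growth.

Variables (R : realFieldType) (r : R).
Hypothesis r_gt0 : 0 < r.
Hypothesis r_adm : 1 + 2 * r <= r * (1 + r) ^+ 2.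

Let L := 1 + r.

Definition box_sum (I : seq nat) : R :=
  \sum_(u <- permutations I | box_free u) r ^+ (2 * asc1 u).

Lemma box_sum_ge0 I : 0 <= box_sum I.
Proof. by apply: sumr_ge0 => u _; rewrite exprn_ge0 // ltW. Qed.

Lemma perm_window (u : seq nat) (a k b m : nat) :
  perm_eq u (iota a (k + m)) -> b = (a + k)%N ->
  perm_eq [seq z <- u | (z < b)%N] (iota a k)
  /\ perm_eq [seq z <- u | ~~ (z < b)%N] (iota b m).
Proof.
move=> pu ->; split; apply: perm_trans (perm_filter _ pu) _;
  rewrite iotaD filter_cat.
- rewrite (eq_in_filter (a2 := predT)) ?filter_predT; last first.
    by move=> z; rewrite mem_iota => /andP[].
  rewrite [X in _ ++ X](eq_in_filter (a2 := pred0)) ?filter_pred0 ?cats0 //.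
  by move=> z; rewrite mem_iota => /andP[h _]; rewrite ltnNge h.
- rewrite (eq_in_filter (a2 := pred0)) ?filter_pred0; last first.
    by move=> z; rewrite mem_iota => /andP[_ ->].
  rewrite (eq_in_filter (a2 := predT)) ?filter_predT //.
  by move=> z; rewrite mem_iota => /andP[h _]; rewrite -leqNgt h.
Qed.

(** Each box-free arrangement of the whole interval is a shuffle of box-free
    arrangements of its two halves.  The shuffles are summed as if preceded by
    an entry [M] above all values, so that the first step is a descent and the
    bound for a high last entry applies. *)
Lemma box_sum_split (a k m : nat) :
  box_sum (iota a (k + m))
    <= L / r * L ^+ (k + m) * box_sum (iota a k) * box_sum (iota (a + k) m).
Proof.
rewrite /box_sum; set b := (a + k)%N; set M := (a + (k + m))%N.
pose S := [seq s <- permutations (iota a k) | box_free s].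
pose T := [seq t <- permutations (iota b m) | box_free t].
have ltM u : perm_eq u (iota a (k + m)) -> all (fun z => z < M)%N u.
  by move=> pu; apply/allP => z; rewrite (perm_mem pu) mem_iota => /andP[].
have leM u : perm_eq u (iota a (k + m)) -> all (leq^~ M) u.
  by move=> pu; apply: sub_all (ltM _ pu) => z /ltnW.
have -> : \sum_(u <- permutations (iota a (k + m)) | box_free u) r ^+ (2 * asc1 u)
        = \sum_(u <- [seq u <- permutations (iota a (k + m)) | box_free u])
            weight r false M u.
  rewrite -big_filter big_seq_cond [RHS]big_seq_cond; apply: eq_bigr => u.
  rewrite andbT mem_filter mem_permutations => /andP[/asboolP bf pu].
  rewrite /weight (no_double_asc_ge_head (leM _ pu)) (asc_ge_head (leM _ pu)).
  have := bf 0%N M; rewrite /window (eq_in_filter (a2 := predT)) ?filter_predT.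
    by move=> ->.
  by move=> z /(allP (ltM _ pu)).
apply: le_trans (ler_sum_uniq_sub
  (v := flatten [seq shuffles s t | s <- S, t <- T]) _ _ _) _.
- by rewrite filter_uniq // permutations_uniq.
- move=> u; rewrite mem_filter mem_permutations => /andP[bf pu].
  have [ps pt] := perm_window pu (erefl b).
  apply/flattenP.
  exists (shuffles [seq z <- u | (z < b)%N] [seq z <- u | ~~ (z < b)%N]).
    apply: allpairs_f; rewrite mem_filter mem_permutations ?ps ?pt andbT.
      exact: (box_free_window 0 b bf).
    have -> : [seq z <- u | ~~ (z < b)%N] = window b M u;
      last exact: box_free_window.
    apply: eq_in_filter => z zu; rewrite -leqNgt.
    by rewrite (allP (ltM _ pu) z zu) andbT.
  exact: mem_shuffles.
- by move=> u; exact: weight_ge0.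
rewrite big_flatten /= big_allpairs_dep /=.
rewrite -[\sum_(u <- permutations (iota a k) | _) _]big_filter.
rewrite -[\sum_(u <- permutations (iota b m) | _) _]big_filter -/S -/T.
rewrite -mulrA big_distrlr /= mulr_sumr big_seq [leRHS]big_seq.
apply: ler_sum => s; rewrite mem_filter mem_permutations => /andP[_ ps].
rewrite mulr_sumr big_seq [leRHS]big_seq.
apply: ler_sum => t; rewrite mem_filter mem_permutations => /andP[_ pt].
have sb : all (fun z => z < b)%N s.
  by apply/allP => z; rewrite (perm_mem ps) mem_iota => /andP[].
have tb : all (fun z => b <= z)%N t.
  by apply/allP => z; rewrite (perm_mem pt) mem_iota => /andP[].
have tM : all (leq^~ M) t.
  by apply/allP => z; rewrite (perm_mem pt) mem_iota /M addnA => /andP[_ /ltnW].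
have bM : (b <= M)%N by rewrite /M addnA leq_addr.
have := (shuffle_sum_bounds r_gt0 r_adm false M sb tb).2 bM.
rewrite /shuffle_sum /high_bound /eps => /le_trans; apply.
have -> : rises M t = false.
  by case: (t) tM => //= z t' /andP[zM _]; rewrite ltnNge zM.
rewrite mul1r (asc_ge_head tM) (perm_size ps) (perm_size pt) !size_iota.
by rewrite mulnDr [r ^+ (_ + _)]exprD !mulrA.
Qed.

(** Halving an interval lowers [up_log 2] by one, which produces the exponent;
    rounding is absorbed in using [up_log 2] in place of the logarithm. *)
Lemma box_sum_bound (a n : nat) : (0 < n)%N ->
  box_sum (iota a n) <= (L / r) ^+ n.-1 * L ^+ (n * up_log 2 n).
Proof.
have L0 : 0 < L by rewrite addr_gt0.
have [N leN] := ubnP n; elim: N n a leN => // N IHN n a leN n0.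
have [n1|n2] := leqP n 1.
  have -> : n = 1%N by apply/eqP; rewrite eqn_leq n1.
  rewrite /box_sum /= up_log1 muln0 !expr0 mulr1.
  rewrite /permutations /= big_cons big_nil /asc1 /= ltnn expr0.
  by case: ifP => _; rewrite ?addr0 ?ler01.
have nE : n = (n./2 + (n - n./2))%N by lia.
have k0 : (0 < n./2)%N by lia.
have m0 : (0 < n - n./2)%N by lia.
set k := n./2 in nE k0 m0; set m := (n - k)%N in nE m0.
have kN : (k < N)%N by lia.
have mN : (m < N)%N by lia.
have uE : up_log 2 n = (up_log 2 m).+1.
  have -> : m = (n.-1)./2.+1 by rewrite /m /k; lia.
  by rewrite -{1}(prednK n0) up_log2S //; lia.
have ukm : (up_log 2 k <= up_log 2 m)%N by apply: leq_up_log; lia.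
rewrite {1}nE; apply: le_trans (box_sum_split _ _ _) _.
have L1 : 1 <= L by rewrite lerDl ltW.
have bk : box_sum (iota a k) <= (L / r) ^+ k.-1 * L ^+ (k * up_log 2 m).
  apply: le_trans (IHN _ _ kN k0) _.
  rewrite ler_wpM2l ?exprn_ge0 ?divr_ge0 ?(ltW L0) ?(ltW r_gt0) //.
  by rewrite ler_weXn2l // leq_mul2l ukm orbT.
have bm := IHN m (a + k)%N mN m0.
have c0 : 0 <= L / r * L ^+ (k + m).
  by rewrite mulr_ge0 ?exprn_ge0 ?divr_ge0 ?(ltW L0) ?(ltW r_gt0).
rewrite -mulrA; apply: le_trans (ler_wpM2l c0 (ler_pM _ _ bk bm)) _;
  rewrite ?box_sum_ge0 //.
have -> : (n * up_log 2 n = k + m + (k * up_log 2 m + m * up_log 2 m))%N.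
  by rewrite uE mulnS -mulnDl -nE.
have -> : (n.-1 = (k.-1 + m.-1).+1)%N by lia.
rewrite exprS !exprD le_eqVlt; apply/orP; left; apply/eqP; ring.
Qed.

Hypothesis r_le1 : r <= 1.

Lemma card_avoiders_le (n : nat) : (a_ n)%:R * r ^+ (2 * n) <= box_sum (iota 0 n).
Proof.
rewrite /a_ mulr_natl -sumr_const.
apply: (@le_trans _ _ (\sum_(s in [set s : 'S_n | avoids_box123 s])
                         r ^+ (2 * asc1 (one_line s)))).
  apply: ler_sum => s _; rewrite ler_wiXn2l ?(ltW r_gt0) // leq_mul2l /=.
  by rewrite -[X in (_ <= X)%N](size_one_line s) asc_le_size.
rewrite -big_enum /= -(big_map (@one_line n) predT (fun u => r ^+ (2 * asc1 u))).
rewrite /box_sum -[leRHS]big_filter; apply: ler_sum_uniq_sub.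
- by rewrite map_inj_uniq ?enum_uniq //; exact: one_line_inj.
- move=> u /mapP[s]; rewrite mem_enum inE => av ->.
  by rewrite mem_filter avoids_box_free // mem_permutations perm_one_line.
- by move=> u; rewrite exprn_ge0 // ltW.
Qed.

Lemma r_ge_half : 1 / 2 <= r.
Proof.
rewrite leNgt; apply/negP => r_lt; have := r_adm; have := r_gt0; move: r_lt; nra.
Qed.

(** The slack between [up_log 2 n] and its predecessor is a factor [L ^+ n],
    which goes into the constant 32 >= L ^+ 2 / r ^+ 3. *)
Lemma card_avoiders_bound (n : nat) : (0 < n)%N ->
  (a_ n)%:R <= 2 ^+ (5 * n) * L ^+ (n * (up_log 2 n).-1).
Proof.
move=> n0.
have L0 : 0 < L by rewrite addr_gt0.
have L1 : 1 <= L by rewrite lerDl ltW.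
have L2 : L <= 2 by have := r_le1; rewrite /L; lra.
have rX : 0 < r ^+ (2 * n) by rewrite exprn_gt0.
rewrite -(ler_pM2r rX); apply: le_trans (card_avoiders_le n) _.
apply: le_trans (box_sum_bound 0 n0) _.
have c1 : 1 <= L / r by rewrite ler_pdivlMr // mul1r /L; lra.
apply: (@le_trans _ _ ((L / r) ^+ n * (L ^+ n * L ^+ (n * (up_log 2 n).-1)))).
  rewrite ler_pM ?exprn_ge0 ?divr_ge0 ?(ltW L0) ?(ltW r_gt0) //.
    by rewrite ler_weXn2l // leq_pred.
  rewrite -exprD ler_weXn2l // -mulnS leq_mul2l; case: (up_log 2 n) => [|q]; lia.
rewrite mulrA [leRHS]mulrAC ler_wpM2r ?exprn_ge0 ?(ltW L0) //.
rewrite !exprM -!exprMn ler_pXn2r ?nnegrE ?mulr_ge0 ?invr_ge0 ?exprn_ge0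
  ?(ltW L0) ?(ltW r_gt0) //.
rewrite mulrAC ler_pdivrMr // -mulrA -exprSr.
have rh := r_ge_half.
have q1 : (1 / 2) ^+ 3 <= r ^+ 3 by rewrite ler_pXn2r ?nnegrE //; lra.
have q2 : L * L <= 2 * 2 by rewrite ler_pM //; lra.
have -> : 2 ^+ 5 = 32 :> R by rewrite -natrX.
move: q1; rewrite (_ : (1/2) ^+ 3 = 1 / 8 :> R); last by field.
lra.
Qed.

End Growth.

(** * Admissible numbers and cos (pi / 7) *)

Lemma admissible_sqrt (R : realType) (x : R) : admissible x ->
  [/\ 0 < Num.sqrt x, Num.sqrt x <= 1, Num.sqrt x ^+ 2 = x &
      1 + 2 * Num.sqrt x <= Num.sqrt x * (1 + Num.sqrt x) ^+ 2].
Proof.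
move=> [/andP[x0 x1] adm]; have r0 : 0 < Num.sqrt x by rewrite sqrtr_gt0.
have rx : Num.sqrt x ^+ 2 = x by rewrite sqr_sqrtr // ltW.
split=> //; first by rewrite -[leRHS]sqrtr1 ler_wsqrtr.
rewrite -(ler_pM2l r0); move: adm; rewrite -{1 3}rx => adm; lra.
Qed.

Lemma admissible_sqr (R : realType) (r : R) : 0 < r <= 1 ->
  1 + 2 * r <= r * (1 + r) ^+ 2 -> admissible (r ^+ 2).
Proof.
move=> /andP[r0 r1] adm; split; first by rewrite exprn_gt0 //= expr_le1 // ltW.
rewrite sqrtr_sqr gtr0_norm //.
have -> : 2 * r ^+ 2 + r = r * (1 + 2 * r) by ring.
have -> : r ^+ 2 * (1 + r) ^+ 2 = r * (r * (1 + r) ^+ 2) by ring.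
by rewrite ler_pM2l.
Qed.

Lemma expr_up_log_le (R : realType) (L : R) (n : nat) : 1 <= L -> (0 < n)%N ->
  L ^+ (n * (up_log 2 n).-1) <= n%:R `^ (n%:R * log2 L).
Proof.
move=> L1 n0; have L0 : 0 < L := lt_le_trans ltr01 L1.
have nR : 0 < n%:R :> R by rewrite ltr0n.
have l2 : 0 < ln 2 :> R by rewrite ln_gt0 // ltr1n.
rewrite [leRHS]/powR gt_eqF // -[leLHS]lnK ?posrE ?exprn_gt0 // ler_expR lnXn //.
rewrite -[ln L *+ _]mulr_natl natrM -!mulrA ler_pM2l // /log2.
rewrite [leLHS]mulrC -?mulrA ler_wpM2l ?ln_ge0 // [leRHS]mulrC ler_pdivlMr //.
rewrite mulr_natl -lnXn // ler_ln ?posrE ?exprn_gt0 // -natrX ler_nat.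
have [n1|n1] := leqP n 1; last by rewrite ltnW // up_log_gtn.
by have -> : n = 1%N by lia.
Qed.

Lemma avoiders_bound_admissible (R : realType) (x : R) : admissible x ->
  forall n : nat, (1 <= n)%N ->
    (a_ n)%:R <= 2 ^+ (5 * n) * n%:R `^ (n%:R * log2 (1 + Num.sqrt x)).
Proof.
move=> /admissible_sqrt[r0 r1 _ adm] n n0.
apply: le_trans (card_avoiders_bound r0 adm r1 n0) _.
by rewrite ler_wpM2l ?exprn_ge0 // expr_up_log_le // lerDl ltW.
Qed.

Lemma cos_mulr3n (R : realType) (t : R) : cos (t *+ 3) = 4 * cos t ^+ 3 - 3 * cos t.
Proof.
rewrite mulrS cosD cos_mulr2n sin_mulr2n.
have -> : cos t * (cos t ^+ 2 *+ 2 - 1) - sin t * (cos t * sin t *+ 2)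
  = 4 * cos t ^+ 3 - 3 * cos t + 2 * cos t * (1 - (cos t ^+ 2 + sin t ^+ 2)) by ring.
by rewrite cos2Dsin2 subrr mulr0 addr0.
Qed.

Lemma cos_mulr4n (R : realType) (t : R) :
  cos (t *+ 4) = 8 * cos t ^+ 4 - 8 * cos t ^+ 2 + 1.
Proof. by rewrite (mulrnA t 2 2) !cos_mulr2n; ring. Qed.

(** cos (2 * pi / 7) > 0 already gives 2 * cos (pi / 7) ^ 2 > 1. *)
Lemma cos_pi7_gt_half (R : realType) : 1 / 2 < cos (pi / 7) :> R.
Proof.
have p0 := pi_gt0 R.
have c0 : 0 < cos (pi / 7) :> R.
  by apply: cos_gt0_pihalf; apply/andP; split; lra.
have : 0 < cos (pi / 7 *+ 2) :> R.
  by apply: cos_gt0_pihalf; apply/andP; split; lra.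
by rewrite cos_mulr2n; nra.
Qed.

(** At t = pi / 7, cos (4 t) = - cos (3 t); written in cos t, this relation has
    the spurious factor cos t + 1, which is removed. *)
Lemma cos_pi7_cubic (R : realType) :
  8 * cos (pi / 7) ^+ 3 - 4 * cos (pi / 7) ^+ 2 - 4 * cos (pi / 7) + 1 = 0 :> R.
Proof.
have c43 : cos (pi / 7 *+ 4) = - cos (pi / 7 *+ 3) :> R.
  by rewrite -[cos (_ *+ 3)]cosN -cosDpi; congr cos; field.
have c0 := cos_pi7_gt_half R.
apply: (@mulfI _ (cos (pi / 7) + 1)); first by rewrite gt_eqF //; lra.
by rewrite mulr0 -[RHS](subrr (cos (pi / 7 *+ 4))) {2}c43 cos_mulr3n cos_mulr4n; ring.
Qed.

(** The difference of the cubic at r and q is r - q times a factor that is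
    positive as soon as r > 1 / 2. *)
Lemma cubic_root_least (R : realFieldType) (q r : R) : 1 / 2 < r -> 0 < q ->
  1 + 2 * r = r * (1 + r) ^+ 2 -> 1 + 2 * q <= q * (1 + q) ^+ 2 -> r <= q.
Proof.
move=> r0 q0 er eq; rewrite leNgt; apply/negP => qr.
have : 0 < (r - q) * (q ^+ 2 + q * r + r ^+ 2 + 2 * (q + r) - 1).
  by apply: mulr_gt0; nra.
lra.
Qed.

Unset Implicit Arguments.

Theorem theorem6p2 (R : realType) :
  (forall x : R, admissible x ->
     forall n : nat, (1 <= n)%N ->
       (a_ n)%:R <= 2 ^+ (5 * n) * n%:R `^ (n%:R * log2 (1 + Num.sqrt x)))
  /\
  (let xstar : R := (2 * cos (pi / 7) - 1) ^+ 2 in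
     admissible xstar /\ forall x : R, admissible x -> xstar <= x)
  /\
  (let beta : R := log2 (2 * cos (pi / 7)) in
     forall n : nat, (1 <= n)%N ->
       (a_ n)%:R <= 2 ^+ (5 * n) * n%:R `^ (beta * n%:R)).
Proof.
have cubic := cos_pi7_cubic R; have c_half := cos_pi7_gt_half R.
have c_le1 := cos_le1 (pi / 7 : R).
set c := cos (pi / 7) in cubic c_half c_le1 *.
have r_gt0 : 0 < 2 * c - 1 by lra.
have r_root : 1 + 2 * (2 * c - 1) = (2 * c - 1) * (1 + (2 * c - 1)) ^+ 2.
  by apply/eqP; rewrite -subr_eq0; apply/eqP; rewrite -[RHS]oppr0 -cubic; ring.
have r_half : 1 / 2 < 2 * c - 1.
  (* the cubic is negative on ]0, 1 / 2], so its positive root lies beyond *)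
  rewrite ltNge; apply/negP => r_le; nra.
have adm_star : admissible ((2 * c - 1) ^+ 2).
  by apply: admissible_sqr; rewrite ?r_root // r_gt0; lra.
split; first exact: avoiders_bound_admissible.
split=> /=; first split=> // x.
  move=> /admissible_sqrt[q0 _ qx adm].
  rewrite -qx ler_pXn2r ?nnegrE ?(ltW r_gt0) ?(ltW q0) //.
  exact: cubic_root_least r_half q0 r_root adm.
move=> n n1; have := avoiders_bound_admissible adm_star n1.
by rewrite sqrtr_sqr gtr0_norm // addrC subrK [n%:R * _]mulrC.
Qed.
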